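(* Let $G$ be a group. Then the power graph $\mathrm{Pow}(G)$ and the enhanced power graph $\mathrm{EPow}(G)$ are equal if and only if $G$ has no subgroup isomorphic to $\mathbb{Z}$ and, for all distinct primes $p,q$, no subgroup isomorphic to $C_p \times C_q$.
   Context: All graphs are undirected and simple. $G$ is an arbitrary (finite or infinite) group. $\mathrm{Pow}(G)$ is the graph with vertex set $G$ in which two distinct vertices $x,y$ are adjacent if one is an (integer) power of the other. $\mathrm{EPow}(G)$ is the graph with vertex set $G$ in which two distinct vertices $x,y$ are adjacent if the subgroup $\langle x,y\rangle$ is cyclic. Equality of two graphs on the vertex set $G$ means that they have the same edge set. $C_n$ denotes the cyclic group of order $n$. *)

(* Defs.v *)
From HB Require Import structures.
From mathcomp Require Import all_boot ssralg ssrint zmodp.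
From mathcomp Require Import boolp classical_sets functions.
Set Implicit Arguments.
Unset Strict Implicit.
Unset Printing Implicit Defensive.

Local Open Scope classical_set_scope.
Local Open Scope group_scope.

(* An undirected simple graph with vertex type V, possibly infinite. *)
Record graph (V : Type) := Graph {
  adj : V -> V -> Prop;
  adj_sym : forall x y, adj x y -> adj y x;
  adj_irrefl : forall x, ~ adj x x
}.

Definition same_edges (V : Type) (A B : graph V) : Prop :=
  forall x y, adj A x y <-> adj B x y.

Section Groups.
Variable G : groupType.
Implicit Types (x y z : G) (H : set G).

(* [Negz n] is the integer [- n.+1]. *)
Definition expgz x (m : int) : G :=
  match m with Posz n => x ^+ n | Negz n => x ^- n.+1 end.

Definition is_power x y : Prop := exists m : int, x = expgz y m.

Definition subgroup H : Prop := group_closed [in H].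

Definition generated (A : set G) : set G := smallest subgroup A.

Definition cyclic_subgroup H : Prop := exists z, H = generated [set z].

(* A multiplicative map between groups automatically preserves 1 and inverses. *)
Definition isomorphic_to (K : groupType) H : Prop :=
  exists f : {multiplicative K -> G}, set_bij [set: K] H f.

Definition has_subgroup_isomorphic_to (K : groupType) : Prop :=
  exists2 H, subgroup H & isomorphic_to K H.

Definition pow_adj x y : Prop := x <> y /\ (is_power x y \/ is_power y x).

Lemma pow_adj_sym x y : pow_adj x y -> pow_adj y x.
Proof. by case=> /nesym xy [] ?; split=> //; [right|left]. Qed.

Lemma pow_adj_irrefl x : ~ pow_adj x x.
Proof. by case. Qed.

Definition Pow : graph G := Graph pow_adj_sym pow_adj_irrefl.

Definition epow_adj x y : Prop :=
  x <> y /\ cyclic_subgroup (generated [set x; y]).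

Lemma epow_adj_sym x y : epow_adj x y -> epow_adj y x.
Proof. by case=> /nesym xy; rewrite setUC; split. Qed.

Lemma epow_adj_irrefl x : ~ epow_adj x x.
Proof. by case. Qed.

Definition EPow : graph G := Graph epow_adj_sym epow_adj_irrefl.

End Groups.

(* The additive group of integers, written multiplicatively. *)
Definition infinite_cyclic : groupType := Algebra.to_multiplicative int.

(* The additive group of integers mod n, written multiplicatively. It has
   order n only for n > 1: 'Z_0 and 'Z_1 both denote the integers mod 2. *)
Definition C (n : nat) : groupType := Algebra.to_multiplicative 'Z_n.

(* Main.v *)
(** Two distinct elements are adjacent in EPow(G) exactly when both are powers
    of some z lying in the subgroup they generate. A monomorphism K -> G
    preserves adjacency in EPow and reflects adjacency in Pow, so Pow(G) and
    EPow(G) differ as soon as some subgroup has an EPow-edge which is not a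
    Pow-edge: 2 and 3 in the integers, (1,0) and (0,1) in C_p x C_q.
    Conversely, if <z> has no subgroup isomorphic to Z or to C_p x C_q, then
    the order of z is a prime power p^k. Each z^a generates the same subgroup
    as some z^(p^i), so the subgroups of <z> form a chain, and one of any two
    powers of z is a power of the other. *)

Require Import Defs.
From HB Require Import structures.
From mathcomp Require Import all_boot ssralg ssrint zmodp.
From mathcomp Require Import boolp classical_sets functions.

Set Implicit Arguments.
Unset Strict Implicit.
Unset Printing Implicit Defensive.

Local Open Scope classical_set_scope.
Local Open Scope group_scope.

(** * Integer powers, generated subgroups, and the inclusion of Pow(G) in EPow(G) *)

Section Subgroups.
Variable G : groupType.
Implicit Types (x y z : G) (H A : set G) (m n : int).

Lemma expgzS x n : expgz x (n + 1)%R = expgz x n * x.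
Proof.
case: n => [n|[|n]] /=; first by rewrite addn1 expgSr.
  by rewrite expg1 mulVg.
by rewrite subn1 [in RHS]expgS invgM mulgVK.
Qed.

Lemma expgzD x m n : expgz x (m + n)%R = expgz x m * expgz x n.
Proof.
elim/int_rect: n => [|n IH|n IH]; first by rewrite GRing.addr0 mulg1.
  by rewrite -addn1 PoszD GRing.addrA !expgzS IH mulgA.
(* Right multiplication by [x] turns the exponent -(n+1) into -n. *)
apply: (mulIg x); rewrite -mulgA -!expgzS -GRing.addrA.
have -> : (- Posz n.+1 + 1 = - Posz n)%R.
  by rewrite -addn1 PoszD GRing.opprD GRing.subrK.
exact: IH.
Qed.

Lemma expgzN x n : expgz x (- n)%R = (expgz x n)^-1.
Proof. by apply: (mulIg (expgz x n)); rewrite -expgzD GRing.addNr mulVg. Qed.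

Lemma subgroupE H :
  subgroup H <-> H 1 /\ forall x y, H x -> H y -> H (x / y).
Proof.
rewrite /subgroup /group_closed /divg_closed.
split=> [[H1 HB]|[H1 HB]]; split.
- by move: H1; rewrite !inE.
- by move=> x y Hx Hy; move: (HB x y); rewrite !inE; apply.
- by rewrite !inE.
- by move=> x y; rewrite !inE; apply: HB.
Qed.

Lemma subgroup_expgz H x n : subgroup H -> H x -> H (expgz x n).
Proof.
move=> /subgroupE[H1 HB] Hx.
have HV y : H y -> H y^-1 by rewrite -div1g; apply: HB.
have HX k : H (x ^+ k).
  elim: k => [|k IH]; first by rewrite expg0.
  by rewrite expgS -[x ^+ k]invgK; apply: HB => //; apply: HV.
by case: n => n; [exact: HX|exact/HV/HX].
Qed.

Lemma subgroup_generated A : subgroup (generated A).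
Proof.
apply/subgroupE; split=> [H [/subgroupE[]]|x y Ax Ay H [sH AH]] //.
by have /subgroupE[_] := sH; apply; [exact: Ax|exact: Ay].
Qed.

Lemma generated_set1 z x : generated [set z] x <-> is_power x z.
Proof.
split=> [|[m ->]]; last first.
  by apply: subgroup_expgz (subgroup_generated _) _; apply: sub_gen_smallest.
apply: (@smallest_sub _ _ _ [set y | is_power y z]).
  apply/subgroupE; split; first by exists (Posz 0).
  by move=> _ _ [m ->] [n ->]; exists (m - n)%R; rewrite expgzD expgzN.
by move=> _ ->; exists (Posz 1); rewrite /= expg1.
Qed.

(** The conditions on [z] amount to the two inclusions between the subgroups generated by [x], [y]
    and by [z]. *)
Lemma epow_adjE x y :
  epow_adj x y <-> x <> y /\
    exists z, [/\ is_power x z, is_power y z & generated [set x; y] z].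
Proof.
split=> -[xy [z]].
  move=> xyz; split=> //; exists z.
  split; try (apply/generated_set1; rewrite -xyz).
  - by apply: sub_gen_smallest; left.
  - by apply: sub_gen_smallest; right.
  - by rewrite xyz; apply: sub_gen_smallest.
case=> xz yz zxy; split=> //; exists z; apply/seteqP; split.
  apply: smallest_sub; first exact: subgroup_generated.
  by move=> _ [] ->; apply/generated_set1.
by apply: smallest_sub; [exact: subgroup_generated|move=> _ ->].
Qed.

(** If [x] is a power of [y], then [y] alone generates the subgroup of [x] and [y]. *)
Lemma sub_pow_epow x y : pow_adj x y -> epow_adj x y.
Proof.
have is_power_refl z : is_power z z by exists (Posz 1); rewrite /= expg1.
case=> xy xyP; apply/epow_adjE; split=> //.
case: xyP => [xy1|yx1]; [exists y|exists x]; split=> //;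
  apply: sub_gen_smallest; by [right|left].
Qed.

End Subgroups.

(** * Adjacency under monomorphisms *)

Section Embeddings.
Variables (K G : groupType) (f : {multiplicative K -> G}).

Lemma multiplicative1 : f 1 = 1.
Proof. by apply: (mulIg (f 1)); rewrite -gmulfM !mul1g. Qed.

Lemma multiplicativeV : {morph f : x / x^-1}.
Proof.
by move=> x; apply: (mulIg (f x)); rewrite -gmulfM !mulVg multiplicative1.
Qed.

Lemma multiplicative_expgz x n : f (expgz x n) = expgz (f x) n.
Proof.
have fX k : f (x ^+ k) = f x ^+ k.
  by elim: k => [|k IH]; rewrite ?multiplicative1 // !expgS gmulfM IH.
by case: n => n; rewrite /= ?multiplicativeV fX.
Qed.

Lemma multiplicative_epow_adj x y :
  injective f -> epow_adj x y -> epow_adj (f x) (f y).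
Proof.
move=> f_inj /epow_adjE[xy [z [[m xz] [n yz] zxy]]]; apply/epow_adjE.
split=> [/f_inj//|]; exists (f z); split.
- by exists m; rewrite xz multiplicative_expgz.
- by exists n; rewrite yz multiplicative_expgz.
have /subgroupE[H1 HB] := subgroup_generated [set f x; f y].
(* The preimage of the subgroup generated by [f x] and [f y] is a subgroup containing [x] and [y],
   hence [z]. *)
apply: (@smallest_sub _ _ _ (f @^-1` generated [set f x; f y])) zxy.
  apply/subgroupE; split; first by rewrite /= multiplicative1.
  by move=> a b Ha Hb; rewrite /= gmulfM multiplicativeV; apply: HB.
by move=> _ [] ->; apply: sub_gen_smallest; [left|right].
Qed.

Lemma multiplicative_pow_adj x y :
  injective f -> pow_adj (f x) (f y) -> pow_adj x y.
Proof.
move=> f_inj [xy fxy]; split; first by move=> xy1; apply: xy; rewrite xy1.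
case: fxy => -[m]; rewrite -multiplicative_expgz => /f_inj ->.
  by left; exists m.
by right; exists m.
Qed.

End Embeddings.

(** The subgroup is the range of [f]; a trivial kernel makes [f] injective. *)
Lemma morph_has_subgroup (K G : groupType) (f : K -> G) :
    {morph f : x y / x * y} -> (forall x, f x = 1 -> x = 1) ->
  has_subgroup_isomorphic_to G K.
Proof.
move=> fM f_ker.
pose fA := isMultiplicative.Build K G f fM.
pose F : {multiplicative K -> G} := HB.pack f fA.
have fV : {morph f : x / x^-1} := multiplicativeV F.
exists (range f).
  apply/subgroupE; split; first by exists 1 => //; exact: (multiplicative1 F).
  by move=> a b [x _ <-] [y _ <-]; exists (x / y) => //; rewrite fM fV.
exists F; split=> // x y _ _ fxy; apply: divg1_eq; apply: f_ker.
by rewrite fM fV [f x]fxy mulgV.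
Qed.

Lemma same_edges_subgroup (G K : groupType) (x y : K) :
    same_edges (Pow G) (EPow G) -> has_subgroup_isomorphic_to G K ->
  epow_adj x y -> pow_adj x y.
Proof.
move=> PE [H _ [f [_ f_inj _]]] xyE.
have {}f_inj : injective f by move=> a b; apply: f_inj; rewrite inE.
apply: (multiplicative_pow_adj f_inj); apply/PE.
exact: multiplicative_epow_adj.
Qed.

(** * The edge between 2 and 3 in the integers *)

Lemma expgz_infinite_cyclic (k : infinite_cyclic) (m : int) :
  expgz k m = (m * (k : int))%R.
Proof.
have kX n : k ^+ n = (Posz n * (k : int))%R.
  elim: n => [|n IH]; first by rewrite expg0 GRing.mul0r.
  by rewrite expgS IH -add1n PoszD GRing.mulrDl GRing.mul1r.
by case: m => n; rewrite /= kX // NegzE GRing.mulNr.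
Qed.

Lemma infinite_cyclic_epow : @epow_adj infinite_cyclic (Posz 2) (Posz 3).
Proof.
apply/epow_adjE; split=> //; exists (Posz 1); split.
- by exists (Posz 2); rewrite expgz_infinite_cyclic.
- by exists (Posz 3); rewrite expgz_infinite_cyclic.
pose a : infinite_cyclic := Posz 2; pose b : infinite_cyclic := Posz 3.
have /subgroupE[_ HB] := subgroup_generated [set a; b].
(* The generator 1 is 3 - 2, which is [b / a] in multiplicative notation. *)
by apply: (HB b a); apply: sub_gen_smallest; [right|left].
Qed.

Lemma infinite_cyclic_not_pow : ~ @pow_adj infinite_cyclic (Posz 2) (Posz 3).
Proof.
have ndvd (a b : nat) : ~~ (b %| a) ->
    ~ @is_power infinite_cyclic (Posz a) (Posz b).
  move=> /negP nba [m]; rewrite expgz_infinite_cyclic => /(congr1 absz).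
  by rewrite abszM => /= e; apply: nba; rewrite e dvdn_mull.
by case=> _ []; apply: ndvd.
Qed.

(** * The edge between (1,0) and (0,1) in a product of two cyclic groups *)

Lemma expg_pair (K L : groupType) (x : K * L) n : x ^+ n = (x.1 ^+ n, x.2 ^+ n).
Proof. by elim: n => [|n IH] //; rewrite !expgS IH. Qed.

Lemma expgz_pair (K L : groupType) (x : K * L) m :
  expgz x m = (expgz x.1 m, expgz x.2 m).
Proof. by case: m => n; rewrite /= expg_pair. Qed.

Lemma expgz1 (G : groupType) m : expgz (1 : G) m = 1.
Proof. by case: m => n; rewrite /= expg1n ?invg1. Qed.

Definition C_generator (n : nat) : C n := (1%R : 'Z_n).

Lemma expg_C_generator p n : C_generator p ^+ n = (n%:R%R : 'Z_p).
Proof.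
by elim: n => // n IH; rewrite expgS IH /C_generator -add1n GRing.natrD.
Qed.

(** True for every [p], because ['Z_p] always has at least two elements. *)
Lemma C_generator_neq1 p : C_generator p <> 1.
Proof. by move/(congr1 val). Qed.

Lemma expg_C_generator_eq p m n :
  1 < p -> m = n %[mod p] -> C_generator p ^+ m = C_generator p ^+ n.
Proof.
move=> p_gt1 e; rewrite !expg_C_generator; apply: val_inj.
by rewrite /= !val_Zp_nat.
Qed.

Section CyclicProduct.
Variables p q : nat.
Hypotheses (p_gt1 : 1 < p) (q_gt1 : 1 < q) (co_pq : coprime p q).

Let u : C p * C q := (C_generator p, 1).
Let v : C p * C q := (1, C_generator q).

(** The product of [u] and [v] generates: the Chinese remainder theorem gives exponents congruent to
    1 modulo one of [p], [q] and to 0 modulo the other. *)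
Lemma C_product_epow : epow_adj u v.
Proof.
apply/epow_adjE; split; first by move/(congr1 fst)/C_generator_neq1.
exists (C_generator p, C_generator q); split.
- exists (Posz (chinese p q 1 0)); rewrite expgz_pair /=; congr (_, _).
    by rewrite (expg_C_generator_eq p_gt1 (chinese_modl co_pq 1 0)) expg1.
  by rewrite (expg_C_generator_eq q_gt1 (chinese_modr co_pq 1 0)) expg0.
- exists (Posz (chinese p q 0 1)); rewrite expgz_pair /=; congr (_, _).
    by rewrite (expg_C_generator_eq p_gt1 (chinese_modl co_pq 0 1)) expg0.
  by rewrite (expg_C_generator_eq q_gt1 (chinese_modr co_pq 0 1)) expg1.
have sH := subgroup_generated [set u; v].
have Hu : generated [set u; v] u by apply: sub_gen_smallest; left.
have Hv : generated [set u; v] v by apply: sub_gen_smallest; right.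
(* [Negz 0] is -1, so this writes the product of [u] and [v] as a quotient, the form under which
   subgroups are closed. *)
have -> : (C_generator p, C_generator q) = u / expgz v (Negz 0).
  rewrite /= expg1 invgK; congr (_, _); first by rewrite /= mulg1.
  by rewrite /= mul1g.
have /subgroupE[_ HB] := sH.
exact: HB Hu (subgroup_expgz (Negz 0) sH Hv).
Qed.

(** Powers of [v] have trivial first component, powers of [u] trivial second component. *)
Lemma C_product_not_pow : ~ pow_adj u v.
Proof.
case=> _ [] [m]; rewrite expgz_pair.
  by move/(congr1 fst); rewrite /= expgz1 => /C_generator_neq1.
by move/(congr1 snd); rewrite /= expgz1 => /C_generator_neq1.
Qed.

End CyclicProduct.

(** * Elements of finite order and their powers *)

Section Torsion.
Variables (G : groupType) (z : G).

(** If no positive power of [z] were trivial, the map from [m] to the [m]-th power of [z] would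
    embed the integers. *)
Lemma torsion_of_no_infinite_cyclic :
    ~ has_subgroup_isomorphic_to G infinite_cyclic ->
  exists2 n, 0 < n & z ^+ n = 1.
Proof.
move=> noZ; apply: contrapT => no_order; apply: noZ.
have zX n : z ^+ n = 1 -> n = 0.
  by case: n => // n zn; case: no_order; exists n.+1.
apply: (@morph_has_subgroup infinite_cyclic G (expgz z)).
  by move=> m n; apply: expgzD.
case=> n /= e; first by rewrite (zX _ e).
by have := zX n.+1; rewrite -[z ^+ _]invgK e invg1 => /(_ erefl).
Qed.

Lemma torsion_order :
    (exists2 n, 0 < n & z ^+ n = 1) ->
  exists2 n, 0 < n & forall k, z ^+ k = 1 <-> n %| k.
Proof.
case=> n0 n0_gt0 zn0.
have ex : exists n, (0 < n) && (z ^+ n == 1).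
  by exists n0; rewrite n0_gt0 zn0 eqxx.
case: (ex_minnP ex) => n /andP[n_gt0 /eqP zn] n_min; exists n => // k.
split=> [zk|/dvdnP[c ->]]; last by rewrite mulnC expgnA zn expg1n.
apply: contraT; rewrite /dvdn -lt0n => r_gt0.
have zr : z ^+ (k %% n) = 1.
  by move: zk; rewrite {1}(divn_eq k n) expgnDr mulnC expgnA zn expg1n mul1g.
have := n_min (k %% n); rewrite r_gt0 zr eqxx => /(_ isT).
by rewrite leqNgt ltn_mod n_gt0.
Qed.

Variable n : nat.
Hypotheses (n_gt0 : 0 < n) (zE : forall k, z ^+ k = 1 <-> n %| k).

Lemma expg_order_modn k : z ^+ (k %% n) = z ^+ k.
Proof.
have zn : z ^+ n = 1 by apply/zE.
by rewrite [in RHS](divn_eq k n) expgnDr mulnC expgnA zn expg1n mul1g.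
Qed.

Lemma is_power_expg x : is_power x z -> exists a, x = z ^+ a.
Proof.
case=> -[a ->|a ->]; first by exists a.
have zV : z ^+ n.-1 = z^-1.
  by apply: (mulIg z); rewrite mulVg -expgSr prednK //; apply/zE.
by exists (n.-1 * a.+1)%N; rewrite expgnA zV expVgn.
Qed.

(** Bezout gives [d] with gcd(a,n) congruent to -da modulo n; hence b = c gcd(a,n) is congruent to
    -(dc)a. *)
Lemma dvdn_gcdn_is_power a b : gcdn a n %| b -> is_power (z ^+ b) (z ^+ a).
Proof.
case/dvdnP=> c ->; have [d _] := Bezoutr a n_gt0.
move=> n_dvd; exists (- Posz (d * c)%N)%R; rewrite expgzN /= -expgnA.
apply: (mulIg (z ^+ (a * (d * c))%N)); rewrite mulVg -expgnDr.
by apply/zE; rewrite mulnA (mulnC a) (mulnC _ c) -mulnDr dvdn_mull.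
Qed.

Lemma pnat_is_power p x y : prime p -> p.-nat n ->
  is_power x z -> is_power y z -> is_power x y \/ is_power y x.
Proof.
move=> p_pr /p_natP[k nE] /is_power_expg[a ->] /is_power_expg[b ->].
(* Both gcds with [n] are powers of [p], so one divides the other and hence the other exponent. *)
have gcdE c : exists i, gcdn c n = (p ^ i)%N.
  have := dvdn_gcdr c n; rewrite [X in _ %| X]nE.
  by case/(dvdn_pfactor _ _ p_pr)=> i _ ->; exists i.
have [[i aE] [j bE]] := (gcdE a, gcdE b).
have [ij|ji] := leqP i j; [right|left]; apply: dvdn_gcdn_is_power.
  by rewrite aE (dvdn_trans (dvdn_exp2l p ij)) // -bE dvdn_gcdl.
by rewrite bE (dvdn_trans (dvdn_exp2l p (ltnW ji))) // -aE dvdn_gcdl.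
Qed.

(** The embedding sends (a,b) to the power of [z] with exponent (n/p)a + (n/q)b. *)
Lemma C_product_has_subgroup p q :
    prime p -> prime q -> p <> q -> p %| n -> q %| n ->
  has_subgroup_isomorphic_to G (C p * C q)%type.
Proof.
move=> p_pr q_pr p_neq_q p_n q_n.
have p_gt1 := prime_gt1 p_pr; have q_gt1 := prime_gt1 q_pr.
(* Reducing a + b modulo r changes (n/r)(a + b) by a multiple of n only. *)
have expD r (a b : 'Z_r) : 1 < r -> r %| n ->
    z ^+ (n %/ r * (a + b)%R)%N = z ^+ (n %/ r * a)%N * z ^+ (n %/ r * b)%N.
  move=> r_gt1 r_n; rewrite -expgnDr -mulnDr /=.
  by rewrite [X in _ %% X]Zp_cast // muln_modr divnK // expg_order_modn.
pose f (w : C p * C q) :=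
  z ^+ (n %/ p * (w.1 : 'Z_p))%N * z ^+ (n %/ q * (w.2 : 'Z_q))%N.
(* Multiplying the exponent by s makes its second term a multiple of n. Cancelling n/r then leaves r
   dividing sa, so r divides a, and a < r. *)
have ker r s (a : 'Z_r) (b : 'Z_s) : prime r -> prime s -> r <> s ->
    r %| n -> s %| n -> z ^+ (n %/ r * a + n %/ s * b)%N = 1 -> a = 0%R.
  move=> r_pr s_pr r_neq_s r_n s_n /zE/(dvdn_mulr s).
  rewrite mulnDl mulnAC [(n %/ s * b * s)%N]mulnAC divnK //.
  rewrite dvdn_addl; last exact: dvdn_mulr.
  rewrite -{1}(divnK r_n) -mulnA dvdn_pmul2l; last first.
    by rewrite divn_gt0 ?prime_gt0 // dvdn_leq.
  rewrite Euclid_dvdM // dvdn_prime2 // => /orP[/eqP//|r_a].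
  apply: val_inj => /=; apply/eqP; rewrite -leqn0 leqNgt; apply/negP => a_gt0.
  have := dvdn_leq a_gt0 r_a; rewrite leqNgt.
  by have := ltn_ord a; rewrite [X in _ < X]Zp_cast ?prime_gt1 // => ->.
apply: (@morph_has_subgroup _ _ f) => [[a1 b1] [a2 b2]|[a b]].
  rewrite /f /= (expD p) // (expD q) // !mulgA; congr (_ * _).
  by rewrite -!mulgA; congr (_ * _); apply: commuteX2.
rewrite /f /= -expgnDr => e; congr (_, _); first exact: ker e.
by rewrite addnC in e; apply: ker e => //; apply: nesym.
Qed.

End Torsion.

(** * Groups whose power graph and enhanced power graph coincide *)

Theorem theorem1 (G : groupType) :
  same_edges (Pow G) (EPow G) <->
  ~ has_subgroup_isomorphic_to G infinite_cyclic /\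
  (forall p q : nat, prime p -> prime q -> p <> q ->
     ~ has_subgroup_isomorphic_to G (C p * C q)%type).
Proof.
split=> [PE|[noZ noC] x y].
  split=> [hZ|p q p_pr q_pr p_neq_q hC].
    apply: infinite_cyclic_not_pow.
    exact: same_edges_subgroup PE hZ infinite_cyclic_epow.
  apply: (@C_product_not_pow p q); apply: same_edges_subgroup PE hC _.
  apply: C_product_epow; rewrite ?prime_gt1 //.
  by rewrite prime_coprime // dvdn_prime2 //; apply/eqP.
split; first exact: sub_pow_epow.
case/epow_adjE=> xy [z [xz yz _]]; split=> //.
have [n n_gt0 zE] := torsion_order (torsion_of_no_infinite_cyclic z noZ).
have [p p_pr p_n] : exists2 p, prime p & p.-nat n.
  have [n_le1|n_gt1] := leqP n 1.
    (* For n = 1 any prime serves; 2 is an arbitrary choice. *)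
    by exists 2 => //; have -> : n = 1%N by apply/eqP; rewrite eqn_leq n_le1.
  have p_pr := pdiv_prime n_gt1.
  (* A prime divisor of [n] other than the least one would give a forbidden product of two cyclic
     groups. *)
  exists (pdiv n) => //; apply/(pnatP _ n_gt0) => q q_pr q_n.
  apply: contraT => /eqP q_neq_p; case: (noC q (pdiv n)) => //.
  exact: (C_product_has_subgroup n_gt0 zE) (pdiv_dvd n).
exact: (pnat_is_power n_gt0 zE p_pr p_n).
Qed.
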